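(* Let $a\in\mathbb{A}$. Then the closure (in $\mathrm{O}(8)$) of the union of all groups $G_{a,b}$ with $b\ne 1$ odd and $\gcd(a,b)=1$, $$\mathbf{G}_a=\overline{\bigcup_{b}G_{a,b}},$$ satisfies $$\mathbf{G}_a=\left\langle C,Q,S,V,D(\psi)\ \middle|\ \psi\in S^1\right\rangle$$ and is a compact Lie group of dimension $1$. Its natural $8$-dimensional representation on $\mathbb{R}^8$ is absolutely irreducible, and it possesses isotropy subgroups with one-dimensional fixed point spaces.
   Context: Let $\mathbb{A}$ be the set of all finite products $\prod_{i=1}^r a_i^{s_i}$ with $r\ge1$, $s_i\ge1$ and primes $a_i\equiv 1 \bmod 4$. For each $a\in\mathbb{A}$ fix (once and for all) an odd $\rho\in\{0,\dots,a-1\}$ with $\rho^2\equiv -1\bmod a$ (such $\rho$ exists). Let $\mathbf{r}(\psi)=\begin{pmatrix}\cos\psi&-\sin\psi\\ \sin\psi&\cos\psi\end{pmatrix}$ and $$c=\begin{pmatrix}\mathbf{r}(\pi/a)&0\\0&\mathbf{r}(\pi/a)\end{pmatrix},\quad d(\psi)=\begin{pmatrix}\mathbf{r}(-\psi)&0\\0&\mathbf{r}(\psi)\end{pmatrix},$$ $$q=\begin{pmatrix}0&0&1&0\\0&0&0&1\\-1&0&0&0\\0&-1&0&0\end{pmatrix},\quad s=\begin{pmatrix}0&0&-1&0\\0&0&0&1\\1&0&0&0\\0&-1&0&0\end{pmatrix}.$$ In $4\times4$ blocks define $$C=\begin{pmatrix}c&0\\0&c^\rho\end{pmatrix},\ D(\psi)=\begin{pmatrix}d(\psi)&0\\0&d(\psi)\end{pmatrix},\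 Q=\begin{pmatrix}q&0\\0&-q\end{pmatrix},\ S=\begin{pmatrix}s&0\\0&s\end{pmatrix},\ V=\begin{pmatrix}0&\mathbf{1}_4\\ s&0\end{pmatrix},$$ for $\psi\in S^1=\mathbb{R}/2\pi\mathbb{Z}$. For $a\in\mathbb{A}$ and odd $b\ge3$ with $\gcd(a,b)=1$ let $G_{a,b}=\langle C,D(\pi/b),Q,S,V\rangle$. A real representation is absolutely irreducible if the only linear maps commuting with the group action are real multiples of the identity. The isotropy subgroup of a point $x$ is its stabilizer, and the fixed point space of a subgroup $K$ is $\mathrm{Fix}(K)=\{x: kx=x \text{ for all } k\in K\}$. *)

(* Defs.v *)
From HB Require Import structures.
From mathcomp Require Import all_boot all_order all_algebra.
From mathcomp Require Import all_classical all_reals all_analysis.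

Set Implicit Arguments.
Unset Strict Implicit.
Unset Printing Implicit Defensive.

Import Order.TTheory GRing.Theory Num.Theory.
Import numFieldNormedType.Exports.

Local Open Scope classical_set_scope.
Local Open Scope ring_scope.

Section MatrixGroups.
Context {R : realType} {n : nat}.
Implicit Types (G X : set 'M[R]_n).

Definition is_matrix_group G : Prop :=
  [/\ G `<=` [set A | A \in unitmx],
      G 1%:M,
      forall A B, G A -> G B -> G (A *m B) &
      forall A, G A -> G (invmx A)].

(* Meaningful when X consists of invertible matrices; otherwise no matrix
   group contains X and the intersection defining [smallest] is everything. *)
Definition generated X : set 'M[R]_n := smallest is_matrix_group X.

Definition orthogonal_group : set 'M[R]_n := [set A | A^T *m A = 1%:M].

Definition closure_in (T : topologicalType) (Y X : set T) : set T :=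
  Y `&` closure X.

(* The natural representation lets A act on column vectors by x |-> A *m x. *)
Definition abs_irreducible G : Prop :=
  forall L : {linear 'cV[R]_n -> 'cV[R]_n},
    (forall A x, G A -> L (A *m x) = A *m L x) ->
    exists l : R, forall x, L x = l *: x.

Definition isotropy G (x : 'cV[R]_n) : set 'M[R]_n :=
  [set A | G A /\ A *m x = x].

Definition Fix (K : set 'M[R]_n) : set 'cV[R]_n :=
  [set x | forall A, K A -> A *m x = x].

Definition has_dim (V : set 'cV[R]_n) (d : nat) : Prop :=
  exists W : {vspace 'cV[R]_n}, V = [set x | x \in W] /\ \dim W = d.

End MatrixGroups.

Section LieGroups.
Context {R : realType}.

(* f is C^k on the (open) set U: C^0 is continuity, and f is C^(k+1) when it is
   continuous with all directional derivatives existing and C^k on U. *)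
Fixpoint Ck_on (V W : normedModType R) (k : nat) (U : set V) (f : V -> W)
    : Prop :=
  (forall x, U x -> {for x, continuous f}) /\
  if k is k'.+1 then
    (forall x v, U x -> derivable f x v) /\
    (forall v, Ck_on k' U (fun x => derive f x v))
  else True.

Definition smooth_on (V W : normedModType R) (U : set V) (f : V -> W) : Prop :=
  forall k, Ck_on k U f.

(* M is an embedded smooth submanifold of dimension d of E: near each of its
   points, M is the homeomorphic image of an open subset O of R^d under a
   smooth map phi whose differential is injective at each point of O; the
   continuous inverse of phi is psi. *)
Definition submanifold (E : normedModType R) (d : nat) (M : set E) : Prop :=
  forall p, M p ->
  exists (U : set E) (O : set 'rV[R]_d) (phi : 'rV[R]_d -> E)
         (psi : E -> 'rV[R]_d),
  [/\ open U /\ U p, open O,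
      smooth_on O phi /\
        (forall x v, O x -> derive phi x v = 0 -> v = 0),
      phi @` O = M `&` U &
      (forall x, O x -> psi (phi x) = x) /\ {within M `&` U, continuous psi}].

(* A Lie group of matrices: a subgroup of GL_n(R) which is an embedded
   submanifold of M_n(R).  Its multiplication and inversion are then smooth,
   being restrictions of smooth maps of GL_n(R). *)
Definition matrix_Lie_group (n d : nat) (G : set 'M[R]_n) : Prop :=
  is_matrix_group G /\ submanifold d G.

End LieGroups.

Definition inA (a : nat) : Prop :=
  exists (r : nat) (p s : 'I_r -> nat),
    [/\ (0 < r)%N,
        forall i, (0 < s i)%N,
        forall i, prime (p i) /\ p i = 1 %[mod 4] &
        a = (\prod_(i < r) p i ^ s i)%N].

Section Generators.
Context {R : realType}.

Definition mx_of_rows (m n : nat) (t : seq (seq R)) : 'M[R]_(m, n) :=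
  \matrix_(i < m, j < n) nth 0 (nth [::] t i) j.

Definition mr (psi : R) : 'M[R]_2 :=
  mx_of_rows 2 2 [:: [:: cos psi; - sin psi];
                     [:: sin psi;   cos psi]].

Definition mc (a : nat) : 'M[R]_4 :=
  @block_mx R 2 2 2 2 (mr (pi / a%:R)) 0 0 (mr (pi / a%:R)).

Definition md (psi : R) : 'M[R]_4 :=
  @block_mx R 2 2 2 2 (mr (- psi)) 0 0 (mr psi).

Definition mq : 'M[R]_4 :=
  mx_of_rows 4 4 [:: [::  0;  0;  1;  0];
                     [::  0;  0;  0;  1];
                     [:: -1;  0;  0;  0];
                     [::  0; -1;  0;  0]].

Definition ms : 'M[R]_4 :=
  mx_of_rows 4 4 [:: [::  0;  0; -1;  0];
                     [::  0;  0;  0;  1];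
                     [::  1;  0;  0;  0];
                     [::  0; -1;  0;  0]].

Definition MC (a rho : nat) : 'M[R]_8 :=
  @block_mx R 4 4 4 4 (mc a) 0 0 (mc a ^+ rho).

Definition MD (psi : R) : 'M[R]_8 :=
  @block_mx R 4 4 4 4 (md psi) 0 0 (md psi).

Definition MQ : 'M[R]_8 := @block_mx R 4 4 4 4 mq 0 0 (- mq).

Definition MS : 'M[R]_8 := @block_mx R 4 4 4 4 ms 0 0 ms.

Definition MV : 'M[R]_8 := @block_mx R 4 4 4 4 0 1%:M ms 0.

Definition G_ab (a rho b : nat) : set 'M[R]_8 :=
  generated [set MC a rho; MD (pi / b%:R); MQ; MS; MV].

Definition G_a (a rho : nat) : set 'M[R]_8 :=
  closure_in orthogonal_group
    (\bigcup_(b in [set b | [/\ b != 1%N, odd b & coprime a b]]) G_ab a rho b).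

End Generators.

(* Main.v *)
Require Import Defs.
From HB Require Import structures.
From mathcomp Require Import all_boot all_order all_algebra.
From mathcomp Require Import all_classical all_reals all_analysis.
From mathcomp Require Import ring lra zify.

Import Order.TTheory GRing.Theory Num.Theory.
Import numFieldNormedType.Exports.

Set Implicit Arguments.
Unset Strict Implicit.
Unset Printing Implicit Defensive.

Local Open Scope classical_set_scope.
Local Open Scope ring_scope.

(** Read R^8 as C^4, with coordinates z1, ..., z4, each 2x2 rotation block
    being multiplication by a complex number of modulus 1.  With
    w = exp(i pi / a) the generators become
      C : (w z1, w z2, w^rho z3, w^rho z4),
      D(t) : (e^(-it) z1, e^(it) z2, e^(-it) z3, e^(it) z4),
      Q : (z2, -z1, -z4, z3),
      V : (z3, z4, -conj z2, conj z1),    S = V^2.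
    The rotations D(t) commute with C and V and are inverted by Q; Q commutes
    with C; V Q = Q^3 V; and V C = C^rho V because rho^2 = -1 modulo 2a, both
    rho and a being odd.  Hence the elements D(t) C^k Q^e V^m ([words]) form a
    group, and C, Q, V having finite order, this group is a union of finitely
    many cosets of the circle of all D(t).

    The union is compact, hence closed, and contains every G_{a,b}; conversely
    the multiples of pi / 3^n are dense in R and 3^n is prime to a, so
    D(t) C^k Q^e V^m is a limit of elements of the G_{a,3^n} ([G_a_words]).
    Near one of its points p the group coincides with the coset of p, since
    the finitely many cosets avoiding p form a closed set; there
    t |-> D(t) p is a chart, with inverse given by the arcsine of an entry
    ([circle_chart], [words_submanifold]).

    For the representation, let x = (1, 0, 0, 0).  Its isotropy group contains
    C D(pi/a), which is diagonal with entries 1, w^2, w^(rho-1), w^(rho+1), the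
    last three different from 1, and Q S, which conjugates z1.  So the vectors
    fixed by the isotropy group are the real multiples of x
    ([Fix_isotropy_base_point]).  A linear map commuting with the group maps x
    to such a vector, so it multiplies x, hence every point of the orbit of x,
    by one real number, and this orbit spans R^8 ([words_abs_irreducible]). *)

(** * Block matrices and the relations between the generators *)

Section Relations.
Context {R : realType}.
Implicit Types (x y : R).

Lemma eq_mx2 (A B : 'M[R]_2) :
  A 0 0 = B 0 0 -> A 0 1 = B 0 1 -> A 1 0 = B 1 0 -> A 1 1 = B 1 1 -> A = B.
Proof.
move=> h00 h01 h10 h11; apply/matrixP => i j.
have o2 (k : 'I_2) : k = 0 \/ k = 1.
  by case: k => [[|[|//]] ?]; [left|right]; exact: val_inj.
by case: (o2 i) => ->; case: (o2 j) => ->.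
Qed.

Lemma mrD x y : mr x *m mr y = mr (x + y).
Proof.
by apply: eq_mx2; rewrite !mxE !big_ord_recl !big_ord0 !mxE /= ?sinD ?cosD; ring.
Qed.

Lemma mr0 : mr (0 : R) = 1%:M.
Proof. by apply: eq_mx2; rewrite !mxE /= ?sin0 ?cos0 ?oppr0. Qed.

Lemma mr_pi : mr (pi : R) = - 1%:M.
Proof. by apply: eq_mx2; rewrite !mxE /= ?sinpi ?cospi ?oppr0. Qed.

Lemma tr_mr x : (mr x)^T = mr (- x).
Proof. by apply: eq_mx2; rewrite !mxE /= ?sinN ?cosN ?opprK. Qed.

(** Complex conjugation on R^2 = C. *)
Definition conj_mx : 'M[R]_2 := mx_of_rows 2 2 [:: [:: 1; 0]; [:: 0; -1]].

Lemma tr_conj : conj_mx^T = conj_mx.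
Proof. by apply: eq_mx2; rewrite !mxE. Qed.

Lemma conj_mr x : conj_mx *m mr x = mr (- x) *m conj_mx.
Proof.
by apply: eq_mx2; rewrite !mxE !big_ord_recl !big_ord0 !mxE /= ?sinN ?cosN; ring.
Qed.

Lemma conjK : conj_mx *m conj_mx = 1%:M.
Proof. by apply: eq_mx2; rewrite !mxE !big_ord_recl !big_ord0 !mxE /=; ring. Qed.

(** Block matrices whose declared sizes are 4 and 8: the block constructors
    have sizes 2 + 2 and 4 + 4, which only reduce to these numerals, so that
    general rewriting rules on blocks do not match. *)
Definition B4 (A B C D : 'M[R]_2) : 'M[R]_4 := @block_mx R 2 2 2 2 A B C D.
Definition B8 (A B C D : 'M[R]_4) : 'M[R]_8 := @block_mx R 4 4 4 4 A B C D.

Lemma mul_B4 A B C D A' B' C' D' :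
  B4 A B C D *m B4 A' B' C' D' =
  B4 (A *m A' + B *m C') (A *m B' + B *m D')
     (C *m A' + D *m C') (C *m B' + D *m D').
Proof. exact: (@mulmx_block R 2 2 2 2 2 2). Qed.

Lemma mul_B8 A B C D A' B' C' D' :
  B8 A B C D *m B8 A' B' C' D' =
  B8 (A *m A' + B *m C') (A *m B' + B *m D')
     (C *m A' + D *m C') (C *m B' + D *m D').
Proof. exact: (@mulmx_block R 4 4 4 4 4 4). Qed.

Lemma opp_B4 A B C D : - B4 A B C D = B4 (- A) (- B) (- C) (- D).
Proof. exact: (@opp_block_mx R 2 2 2 2). Qed.

Lemma opp_B8 A B C D : - B8 A B C D = B8 (- A) (- B) (- C) (- D).
Proof. exact: (@opp_block_mx R 4 4 4 4). Qed.

Lemma tr_B4 A B C D : (B4 A B C D)^T = B4 A^T C^T B^T D^T.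
Proof. exact: (@tr_block_mx R 2 2 2 2). Qed.

Lemma tr_B8 A B C D : (B8 A B C D)^T = B8 A^T C^T B^T D^T.
Proof. exact: (@tr_block_mx R 4 4 4 4). Qed.

Lemma B4_1 : B4 1%:M 0 0 1%:M = 1%:M.
Proof. by rewrite /B4 -(@scalar_mx_block R 2 2 1). Qed.

Lemma B8_1 : B8 1%:M 0 0 1%:M = 1%:M.
Proof. by rewrite /B8 -(@scalar_mx_block R 4 4 1). Qed.

Lemma mqE : mq = B4 0 1%:M (- 1%:M) 0 :> 'M[R]_4.
Proof.
rewrite -[LHS](@submxK R 2 2 2 2); apply: (f_equal4 (@block_mx R 2 2 2 2));
  by apply: eq_mx2; rewrite !mxE /= ?oppr0.
Qed.

Lemma msE : ms = B4 0 (- conj_mx) conj_mx 0 :> 'M[R]_4.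
Proof.
rewrite -[LHS](@submxK R 2 2 2 2); apply: (f_equal4 (@block_mx R 2 2 2 2));
  by apply: eq_mx2; rewrite !mxE /= ?oppr0 ?opprK.
Qed.

Lemma mcE a : mc a = B4 (mr (pi / a%:R)) 0 0 (mr (pi / a%:R)) :> 'M[R]_4.
Proof. by []. Qed.

Lemma mc_exp a k :
  mc a ^+ k = B4 (mr ((pi / a%:R) *+ k)) 0 0 (mr ((pi / a%:R) *+ k)) :> 'M[R]_4.
Proof.
elim: k => [|k IH]; first by rewrite expr0 mulr0n mr0 B4_1.
by rewrite exprS IH -[_ * _]/(_ *m _) mcE mul_B4 !(mul0mx, mulmx0, addr0, add0r)
  !mrD mulrS.
Qed.

Definition torus x1 x2 x3 x4 : 'M[R]_8 :=
  B8 (B4 (mr x1) 0 0 (mr x2)) 0 0 (B4 (mr x3) 0 0 (mr x4)).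

Lemma mul_torus x1 x2 x3 x4 y1 y2 y3 y4 :
  torus x1 x2 x3 x4 * torus y1 y2 y3 y4 =
  torus (x1 + y1) (x2 + y2) (x3 + y3) (x4 + y4).
Proof.
rewrite -[_ * _]/(_ *m _) mul_B8 !mul_B4.
by rewrite !(mul0mx, mulmx0, addr0, add0r) !mrD.
Qed.

Lemma exp_torus x1 x2 x3 x4 k :
  torus x1 x2 x3 x4 ^+ k = torus (x1 *+ k) (x2 *+ k) (x3 *+ k) (x4 *+ k).
Proof.
elim: k => [|k IH]; first by rewrite expr0 !mulr0n /torus mr0 !B4_1 B8_1.
by rewrite exprS IH mul_torus -!mulrS.
Qed.

Lemma MC_torus a rho : MC a rho =
  torus (pi / a%:R) (pi / a%:R) ((pi / a%:R) *+ rho) ((pi / a%:R) *+ rho).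
Proof. by rewrite /MC mc_exp. Qed.

Lemma MD_torus x : MD x = torus (- x) x (- x) x.
Proof. by []. Qed.

Lemma torusP x1 x2 x3 x4 y1 y2 y3 y4 :
  mr x1 = mr y1 -> mr x2 = mr y2 -> mr x3 = mr y3 -> mr x4 = mr y4 ->
  torus x1 x2 x3 x4 = torus y1 y2 y3 y4.
Proof. by rewrite /torus => -> -> -> ->. Qed.

Lemma MQE : MQ = B8 (B4 0 1%:M (- 1%:M) 0) 0 0 (B4 0 (- 1%:M) 1%:M 0) :> 'M[R]_8.
Proof. by rewrite -[LHS]/(B8 mq 0 0 (- mq)) mqE opp_B4 !oppr0 opprK. Qed.

Lemma MSE :
  MS = B8 (B4 0 (- conj_mx) conj_mx 0) 0 0 (B4 0 (- conj_mx) conj_mx 0).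
Proof. by rewrite -msE. Qed.

Lemma MVE : MV = B8 0 1%:M (B4 0 (- conj_mx) conj_mx 0) 0.
Proof. by rewrite -msE. Qed.

Let simp := (mul_B4, mul_B8, opp_B4, opp_B8, (mul0mx, mulmx0, mul1mx, mulmx1),
  mulNmx, mulmxN, (addr0, add0r, oppr0, @opprK 'M[R]_2), conjK).

Lemma MV2 : MV ^+ 2 = MS :> 'M[R]_8.
Proof. by rewrite expr2 -[_ * _]/(_ *m _) MVE MSE !simp. Qed.

Lemma MS2 : MS ^+ 2 = -1 :> 'M[R]_8.
Proof.
rewrite expr2 -[_ * _]/(_ *m _) MSE !simp.
by rewrite -[-1]/(- 1%:M) -B8_1 -B4_1 !simp.
Qed.

Lemma MV8 : MV ^+ 8 = 1 :> 'M[R]_8.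
Proof. by rewrite (exprM _ 2 4) MV2 (exprM _ 2 2) MS2 sqrrN expr1n. Qed.

Lemma MQ2 : MQ ^+ 2 = -1 :> 'M[R]_8.
Proof.
rewrite expr2 -[_ * _]/(_ *m _) MQE !simp.
by rewrite -[-1]/(- 1%:M) -B8_1 -B4_1 !simp.
Qed.

Lemma MQ4 : MQ ^+ 4 = 1 :> 'M[R]_8.
Proof. by rewrite (exprM _ 2 2) MQ2 sqrrN expr1n. Qed.

Lemma MVQ : MV * MQ = MQ ^+ 3 * MV :> 'M[R]_8.
Proof.
rewrite exprSr MQ2 mulN1r mulNr -![_ * _]/(_ *m _) MVE MQE !simp.
by [].
Qed.

Lemma MQ_torus x1 x2 x3 x4 :
  MQ * torus x1 x2 x3 x4 = torus x2 x1 x4 x3 * MQ.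
Proof. by rewrite -![_ * _]/(_ *m _) MQE /torus !simp. Qed.

Lemma MV_torus x1 x2 x3 x4 :
  MV * torus x1 x2 x3 x4 = torus x3 x4 (- x2) (- x1) * MV.
Proof. by rewrite -![_ * _]/(_ *m _) MVE /torus !simp !conj_mr. Qed.

Lemma torus_orthogonal x1 x2 x3 x4 : orthogonal_group (torus x1 x2 x3 x4).
Proof.
rewrite /orthogonal_group /=.
rewrite /torus tr_B8 !tr_B4 !tr_mr !trmx0.
rewrite !simp !mrD !addNr mr0.
by rewrite -B8_1 -B4_1.
Qed.

Lemma MQ_orthogonal : orthogonal_group (MQ : 'M[R]_8).
Proof.
rewrite /orthogonal_group /= MQE tr_B8 !tr_B4 !linearN /= !trmx1 !trmx0 !simp.
by rewrite -B8_1 -B4_1.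
Qed.

Lemma MV_orthogonal : orthogonal_group (MV : 'M[R]_8).
Proof.
rewrite /orthogonal_group /= MVE tr_B8 !tr_B4 !linearN /= tr_conj !trmx1 !trmx0.
by rewrite !simp -B8_1 -B4_1.
Qed.

End Relations.

(** * Arithmetic of a and rho, and powers in a ring *)

Lemma inA_odd a : inA a -> odd a.
Proof.
case=> r [p [s [_ _ ps ->]]].
elim/big_ind: _ => // [m n|i _]; first by rewrite oddM => -> ->.
rewrite oddX; apply/orP; right; have [_ pi1] := ps i.
by rewrite (divn_eq (p i) 4) pi1 oddD oddM andbF.
Qed.

Lemma inA_gt2 a : inA a -> (2 < a)%N.
Proof.
move=> ha; have aodd := inA_odd ha; case: ha => r [p [s [r0 s0 ps ae]]].
have [pp p1] := ps (Ordinal r0).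
have dv : (p (Ordinal r0) %| a)%N.
  rewrite ae (bigD1 (Ordinal r0)) //= dvdn_mulr //.
  by apply: dvdn_exp; first exact: s0.
have a0 : (0 < a)%N by case: (a) aodd.
have := dvdn_leq a0 dv; apply: leq_trans.
have := prime_gt1 pp; case: (p (Ordinal r0)) p1 => [|[|[|]]] //.
Qed.

Lemma inA_coprime3 a : inA a -> coprime a 3.
Proof.
case=> r [p [s [_ _ ps ->]]].
elim/big_ind: _ => // [m n|i _]; first by rewrite coprimeMl => -> ->.
apply: coprimeXl; have [pp p1] := ps i.
rewrite coprime_sym prime_coprime // dvdn_prime2 //.
by apply/eqP => p3; move: p1; rewrite -p3.
Qed.

(** C has order 2a, so the congruence satisfied by rho is needed modulo 2a;
    this is where the parity of rho enters. *)
Lemma rho_sq_mod2 a rho : odd a -> odd rho -> (rho ^ 2 + 1 = 0 %[mod a])%N ->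
  exists n, (rho ^ 2 + 1 = n * (2 * a))%N.
Proof.
move=> aodd rodd; rewrite mod0n => /eqP; rewrite -/(dvdn _ _) => h.
apply/dvdnP; rewrite Gauss_dvd ?coprime2n // h andbT.
by rewrite dvdn2 oddD oddX rodd.
Qed.

Lemma expr_swap (T : nzRingType) (v y : T) n k :
  v * y = y ^+ n * v -> v * y ^+ k = y ^+ (n * k) * v.
Proof.
move=> vy; elim: k => [|k IH]; first by rewrite muln0 !expr0 mul1r mulr1.
by rewrite exprSr mulrA IH -mulrA vy mulrA -exprD -mulnSr.
Qed.

Lemma expr_modn (T : nzRingType) (x : T) n k :
  x ^+ n = 1 -> x ^+ (k %% n) = x ^+ k.
Proof.
by move=> h; rewrite [in RHS](divn_eq k n) exprD mulnC exprM h expr1n mul1r.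
Qed.

(** * Generated matrix groups *)

Section MatrixGroupTheory.
Context {R : realType} {n : nat}.
Implicit Types (X G : set 'M[R]_n).

Lemma generated_incl X G : is_matrix_group G -> X `<=` G -> generated X `<=` G.
Proof. by move=> hG XG A; apply; split. Qed.

Lemma sub_generated X : X `<=` generated X.
Proof. by move=> A XA G [_]; apply. Qed.

Lemma generated_mul X A B : generated X A -> generated X B -> generated X (A *m B).
Proof.
move=> hA hB G [hG XG]; have [_ _ GM _] := hG.
by apply: GM; [exact: hA|exact: hB].
Qed.

Lemma generated1 X : generated X 1%:M.
Proof. by move=> G [[_]]. Qed.

Lemma orthogonal_is_group : is_matrix_group (@orthogonal_group R n).
Proof.
split.
- by move=> A /= /mulmx1_unit [].
- by rewrite /orthogonal_group /= trmx1 mulmx1.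
- move=> A B; rewrite /orthogonal_group /= => hA hB.
  by rewrite trmx_mul -mulmxA (mulmxA A^T) hA mul1mx.
- move=> A; rewrite /orthogonal_group /= => hA.
  have uA : A \in unitmx by case/mulmx1_unit: hA.
  by rewrite -[invmx A]mul1mx -hA -mulmxA mulmxV // mulmx1 trmxK mulmx1C.
Qed.

End MatrixGroupTheory.

Lemma generated_expr (R : realType) (n : nat) (X : set 'M[R]_n.+1) A k :
  generated X A -> generated X (A ^+ k).
Proof.
move=> hA; elim: k => [|k IH]; first exact: generated1.
by rewrite exprS; exact: generated_mul.
Qed.

(** * The group of words D(x) C^k Q^e V^m *)

Section NormalForm.
Context {R : realType}.
Variables (a rho : nat).
Hypotheses (aodd : odd a) (a_gt2 : (2 < a)%N) (rho_odd : odd rho)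
  (rho_sq : (rho ^ 2 + 1 = 0 %[mod a])%N).
Implicit Types (x y : R) (A B : 'M[R]_8).

Lemma mr_pi2n k : mr ((pi : R) *+ (2 * k)) = 1%:M.
Proof.
elim: k => [|k IH]; first by rewrite muln0 mulr0n mr0.
by rewrite mulnS mulrnDr -mrD IH mulmx1 mulr2n -mrD mr_pi mulNmx mul1mx opprK.
Qed.

Lemma pi_div_mul k : (pi / a%:R : R) *+ (k * (2 * a)) = pi *+ (2 * k).
Proof.
have a0 : (a%:R : R) != 0 by rewrite pnatr_eq0; case: (a) a_gt2.
rewrite -[LHS]mulr_natr -[RHS]mulr_natr !natrM.
by field.
Qed.

Lemma mrDr_pi2n x k : mr (x + (pi : R) *+ (2 * k)) = mr x.
Proof. by rewrite -mrD mr_pi2n mulmx1. Qed.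

Lemma MC2a : MC a rho ^+ (2 * a) = 1 :> 'M[R]_8.
Proof.
have h : mr (pi / a%:R *+ (2 * a)) = 1%:M :> 'M[R]_2.
  by rewrite -[(2 * a)%N]mul1n pi_div_mul mr_pi2n.
rewrite MC_torus exp_torus -mulrnA pi_div_mul /torus h mr_pi2n.
by rewrite !B4_1 B8_1.
Qed.

Lemma MVC : MV * MC a rho = MC a rho ^+ rho * MV :> 'M[R]_8.
Proof.
rewrite MC_torus MV_torus exp_torus; congr (_ * _).
have [n e] := rho_sq_mod2 aodd rho_odd rho_sq.
have h : mr (- (pi / a%:R : R)) = mr (pi / a%:R *+ rho *+ rho).
  rewrite -[LHS](mrDr_pi2n _ n) -pi_div_mul -e addn1 mulrS addrA addNr add0r.
  by rewrite -mulnn mulrnA.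
exact: torusP.
Qed.

Lemma MCD x : MC a rho * MD x = MD x * MC a rho :> 'M[R]_8.
Proof. by rewrite MC_torus MD_torus !mul_torus; apply: torusP; rewrite addrC. Qed.

Lemma MQD x : MQ * MD x = MD (- x) * MQ :> 'M[R]_8.
Proof. by rewrite !MD_torus MQ_torus opprK. Qed.

Lemma MVD x : MV * MD x = MD x * MV :> 'M[R]_8.
Proof. by rewrite MD_torus MV_torus !opprK. Qed.

Lemma MQC : MQ * MC a rho = MC a rho * MQ :> 'M[R]_8.
Proof. by rewrite MC_torus MQ_torus. Qed.

Lemma MDD x y : MD x * MD y = MD (x + y).
Proof. by rewrite !MD_torus mul_torus -opprD. Qed.

Lemma MD0 : MD (0 : R) = 1.
Proof. by rewrite MD_torus /torus oppr0 mr0 !B4_1 B8_1. Qed.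

Lemma MD_expr x k : MD x ^+ k = MD (x *+ k).
Proof. by rewrite !MD_torus exp_torus !mulNrn. Qed.

Definition word (x : R) (k e m : nat) : 'M[R]_8 :=
  MD x * (MC a rho ^+ k * MQ ^+ e * MV ^+ m).

Definition words : set 'M[R]_8 := [set A | exists x k e m, A = word x k e m].

Lemma words1 : words 1.
Proof. by exists 0, 0%N, 0%N, 0%N; rewrite /word MD0 !expr0 !mulr1. Qed.

Lemma words_mulD y A : words A -> words (MD y * A).
Proof.
by move=> [x [k [e [m ->]]]]; exists (y + x), k, e, m; rewrite /word mulrA MDD.
Qed.

Lemma words_mulC A : words A -> words (MC a rho * A).
Proof.
move=> [x [k [e [m ->]]]]; exists x, k.+1, e, m.
by rewrite /word mulrA MCD -mulrA !mulrA exprS !mulrA.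
Qed.

Lemma words_mulQ A : words A -> words (MQ * A).
Proof.
move=> [x [k [e [m ->]]]]; exists (- x), k, e.+1, m.
have c : MQ * MC a rho ^+ k = MC a rho ^+ k * MQ :> 'M[R]_8.
  by apply: commrX; exact: MQC.
by rewrite /word mulrA MQD -!mulrA exprS (mulrA MQ) c !mulrA.
Qed.

Lemma words_mulV A : words A -> words (MV * A).
Proof.
move=> [x [k [e [m ->]]]]; exists x, (rho * k)%N, (3 * e)%N, m.+1.
rewrite /word mulrA MVD -!mulrA (mulrA MV) (expr_swap k MVC) -!mulrA.
by rewrite (mulrA MV) (expr_swap e MVQ) -!mulrA exprS.
Qed.

(** Closure under products only has to be checked for a single generator on the
    left: each commutation relation moves it to its place in the word. *)
Lemma words_mul A B : words A -> words B -> words (A * B).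
Proof.
have it (T : 'M[R]_8) : (forall A, words A -> words (T * A)) ->
    forall k A, words A -> words (T ^+ k * A).
  move=> hT; elim=> [|k IH] D hD; first by rewrite mul1r.
  by rewrite exprS -mulrA; apply: hT; apply: IH.
move=> [x [k [e [m ->]]]] hB; rewrite /word -!mulrA.
apply: words_mulD.
apply: (it); first exact: words_mulC.
apply: (it); first exact: words_mulQ.
by apply: (it); first exact: words_mulV.
Qed.

Lemma words_gen : [/\ forall x, words (MD x), words (MC a rho), words MQ,
  words MS & words MV].
Proof.
have w1 := words1.
split=> [x||||].
- by rewrite -[MD x]mulr1; exact: words_mulD.
- by rewrite -[MC a rho]mulr1; exact: words_mulC.
- by rewrite -[MQ]mulr1; exact: words_mulQ.
- by rewrite -MV2 -[MV ^+ 2]mulr1 expr2 -mulrA; do 2!apply: words_mulV.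
- by rewrite -[MV]mulr1; exact: words_mulV.
Qed.

(** The inverse of a word is again a product of generators, because C, Q and V
    have finite order and D(x) has inverse D(-x). *)
Lemma words_inv A : words A -> exists2 B, words B & A * B = 1.
Proof.
have wX T k : words T -> words (T ^+ k).
  by move=> hT; elim: k => [|k IH]; [exact: words1|rewrite exprS; exact: words_mul].
have [wD wC wQ wS wV] := words_gen.
have iX (T : 'M[R]_8) n k : T ^+ n.+1 = 1 -> T ^+ k * T ^+ (n * k) = 1.
  by move=> hT; rewrite -exprD -mulSn exprM hT expr1n.
move=> [x [k [e [m ->]]]].
exists (MV ^+ (7 * m) * (MQ ^+ (3 * e) * (MC a rho ^+ ((2 * a).-1 * k) * MD (- x)))).
  by do 3!(apply: words_mul; first exact: wX).
rewrite /word -!mulrA (mulrA (MV ^+ m)) (iX _ _ _ MV8) mul1r.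
rewrite (mulrA (MQ ^+ e)) (iX _ _ _ MQ4) mul1r.
rewrite (mulrA (MC a rho ^+ k)) iX ?mul1r ?MDD ?subrr ?MD0 //.
by rewrite prednK ?MC2a //; case: (a) a_gt2.
Qed.

Lemma words_group : is_matrix_group words.
Proof.
split.
- by move=> A /= /words_inv [B _ /mulmx1_unit []].
- exact: words1.
- by move=> A B; exact: words_mul.
- move=> A /words_inv [B wB AB]; have [uA _] := mulmx1_unit AB.
  by rewrite -[invmx A]mulmx1 -[1%:M]AB mulmxA mulVmx ?mul1mx.
Qed.

Lemma words_orthogonal : words `<=` orthogonal_group.
Proof.
have [_ o1 oM _] := @orthogonal_is_group R 8.
have oX (T : 'M[R]_8) k : orthogonal_group T -> orthogonal_group (T ^+ k).
  by move=> hT; elim: k => [|k IH] //; rewrite exprS; exact: oM.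
move=> _ [x [k [e [m ->]]]]; apply: (oM); first exact: torus_orthogonal.
apply: (oM); last exact/oX/MV_orthogonal.
apply: (oM); apply: oX; last exact: MQ_orthogonal.
by rewrite MC_torus; exact: torus_orthogonal.
Qed.

Definition circle_generators : set 'M[R]_8 :=
  [set MC a rho; MQ; MS; MV] `|` [set MD psi | psi in [set: R]].

Lemma words_generated : words = generated circle_generators.
Proof.
apply/seteqP; split.
  move=> _ [x [k [e [m ->]]]].
  apply: generated_mul; first by apply: sub_generated; right; exists x.
  do 2?apply: generated_mul; apply: generated_expr; apply: sub_generated; left;
    rewrite /=; tauto.
apply: generated_incl; first exact: words_group.
have [wD wC wQ wS wV] := words_gen.
by move=> A [[[[->|->]|->]|->]|[x _ <-]].
Qed.

Lemma G_ab_words b : G_ab a rho b `<=` words.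
Proof.
apply: generated_incl; first exact: words_group.
have [wD wC wQ wS wV] := words_gen.
by move=> A [[[[->|->]|->]|->]|->].
Qed.

Lemma word_G_ab b k l e m : G_ab a rho b (word (pi / b%:R *+ l) k e m).
Proof.
rewrite /word -MD_expr.
apply: generated_mul.
  by apply: generated_expr; apply: sub_generated; rewrite /=; tauto.
do 2?apply: generated_mul; apply: generated_expr; apply: sub_generated; 
    rewrite /=; tauto.
Qed.

End NormalForm.

(** * Cosets of the circle and the closure of the union *)

Section Circle.
Context {R : realType}.
Implicit Types (x y : R) (A B F : 'M[R]_8).

(** The curve x |-> D(x) lies in a plane of matrices; its continuity and its
    derivatives are read off from this formula. *)
Lemma MD_cos_sin x : MD x = cos x *: 1 + sin x *: MD (pi / 2).
Proof.
have h y : mr y = cos y *: 1%:M + sin y *: mr (pi / 2).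
  by apply: eq_mx2; rewrite !mxE /= ?cos_pihalf ?sin_pihalf; ring.
have hN y : mr (- y) = cos y *: 1%:M + sin y *: mr (- (pi / 2)).
  by apply: eq_mx2; rewrite !mxE /= ?cosN ?sinN ?cos_pihalf ?sin_pihalf; ring.
rewrite -[1 in RHS]/(1%:M) -B8_1 -B4_1 !MD_torus /torus /B8 /B4.
rewrite !(@scale_block_mx R 4 4 4 4) !(@scale_block_mx R 2 2 2 2) !scaler0.
rewrite !(@add_block_mx R 4 4 4 4) !(@add_block_mx R 2 2 2 2) !addr0.
by rewrite -h -hN.
Qed.

Lemma MD_mulE x F : MD x * F = cos x *: F + sin x *: (MD (pi / 2) * F).
Proof. by rewrite {1}MD_cos_sin mulrDl -!scalerAl mul1r. Qed.

Lemma continuous_MD F : continuous (fun x => MD x * F).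
Proof.
move=> x.
rewrite (_ : (fun x => _) = fun x => cos x *: F + sin x *: (MD (pi / 2) * F)).
  apply: cvgD; apply: cvgZr_tmp; [exact: continuous_cos|exact: continuous_sin].
by apply/funext => y; exact: MD_mulE.
Qed.

Lemma angle_reduction x :
  exists y, [/\ 0 <= y <= pi *+ 2, cos y = cos x & sin y = sin x].
Proof.
have pi0 := @pi_gt0 R.
have c1 : -1 <= cos x <= 1 by rewrite cos_geN1 cos_le1.
have ac0 := acos_ge0 c1; have acpi := acos_lepi c1.
have ck : cos (acos (cos x)) = cos x by apply: acosK; rewrite in_itv.
have sk : sin (acos (cos x)) = `|sin x|.
  by rewrite sin_acos // -[1](cos2Dsin2 x) addrAC subrr add0r sqrtr_sqr.
have [s0|s0] := leP 0 (sin x).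
  exists (acos (cos x)); rewrite sk ger0_norm //; split => //.
  by rewrite ac0 mulr2n; lra.
exists (- acos (cos x) + pi *+ 2).
rewrite cosD2pi sinD2pi cosN sinN sk ltr0_norm // opprK.
by split => //; rewrite mulr2n; lra.
Qed.

Lemma MD_angle_reduction x : exists2 y, 0 <= y <= pi *+ 2 & MD y = MD x.
Proof.
have [y [y2 cy sy]] := angle_reduction x.
by exists y => //; rewrite MD_cos_sin (MD_cos_sin x) cy sy.
Qed.

Definition circle_coset F : set 'M[R]_8 := [set MD x * F | x in [set: R]].

Lemma circle_coset_compact F : compact (circle_coset F).
Proof.
have -> : circle_coset F = [set MD x * F | x in `[0, pi *+ 2]].
  apply/seteqP; split => [_ [x _ <-]|_ [x _ <-]]; last by exists x.
  by have [y y2 <-] := MD_angle_reduction x; exists y => //=; rewrite in_itv.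
apply: continuous_compact; last exact: segment_compact.
by apply: continuous_subspaceT; exact: continuous_MD.
Qed.

End Circle.

Section ClosedGroup.
Context {R : realType}.
Variables (a rho : nat).
Hypotheses (aodd : odd a) (a_gt2 : (2 < a)%N) (rho_odd : odd rho)
  (rho_sq : (rho ^ 2 + 1 = 0 %[mod a])%N).
Implicit Types (x y : R) (A B F : 'M[R]_8).

Definition coset_rep (i : 'I_(2 * a) * 'I_4 * 'I_8) : 'M[R]_8 :=
  MC a rho ^+ i.1.1 * MQ ^+ i.1.2 * MV ^+ i.2.

(** The exponents are bounded by the orders 2a, 4 and 8 of C, Q and V.  Some
    cosets are listed several times, which is harmless for compactness. *)
Lemma words_cosets : @words R a rho = \bigcup_i circle_coset (coset_rep i).
Proof.
apply/seteqP; split; last first.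
  by move=> _ [[[k e] m] _ [x _ <-]]; exists x, k, e, m.
move=> _ [x [k [e [m ->]]]].
have a20 : (0 < 2 * a)%N by rewrite muln_gt0 (ltn_trans _ a_gt2).
pose k' := Ordinal (ltn_pmod k a20).
pose e' := Ordinal (ltn_pmod e (isT : (0 < 4)%N)).
pose m' := Ordinal (ltn_pmod m (isT : (0 < 8)%N)).
exists ((k', e'), m') => //; exists x => //.
rewrite /word /coset_rep /= !expr_modn //; [exact: MV8|exact: MQ4|exact: MC2a].
Qed.

Lemma finite_union_cosets_compact (P : set ('I_(2 * a) * 'I_4 * 'I_8)) :
  compact (\bigcup_(i in P) circle_coset (coset_rep i)).
Proof.
rewrite -(bigsetU_fset_set _ (finite_finset : finite_set P)).
by apply: bigsetU_compact => i _; exact: circle_coset_compact.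
Qed.

Lemma words_compact : compact (@words R a rho).
Proof. by rewrite words_cosets; exact: finite_union_cosets_compact. Qed.

Lemma words_closed : closed (@words R a rho).
Proof.
apply: compact_closed; [|exact: words_compact].
exact: norm_hausdorff.
Qed.

(** Only the groups G_{a,3^n} are used: 3 is prime to a, and the multiples of
    pi / 3^n come arbitrarily close to any x. *)
Lemma word_closure_G_ab x k e m : coprime a 3 ->
  closure (\bigcup_(b in [set b | [/\ b != 1%N, odd b & coprime a b]])
             @G_ab R a rho b)
    (word a rho x k e m).
Proof.
move=> ca3.
(* A nonnegative angle, so that a natural multiple of pi / b approximates it. *)
have [y /andP[y0 _] yx] := MD_angle_reduction x.
rewrite /word -yx => B /continuous_MD /nbhs_ballP [eps /= eps0 yB].
(* b > n + 1 > pi / eps, so that the grid of step pi / b is eps-fine. *)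
pose n := Num.truncn (pi / eps); pose b := (3 ^ n.+1)%N.
have b0 : 0 < b%:R :> R by rewrite ltr0n expn_gt0.
have bn : pi / eps < b%:R.
  apply: lt_trans (truncnS_gt _) _.
  by rewrite ltr_nat ltn_expl.
have pi0 := @pi_gt0 R.
have pib : pi / b%:R < eps by move: bn; rewrite !ltr_pdivrMr // mulrC.
pose l := Num.truncn (y / (pi / b%:R)).
have pb0 : 0 < pi / b%:R :> R by rewrite divr_gt0.
have /andP[l1 l2] : (l%:R <= y / (pi / b%:R) < l.+1%:R).
  by apply: truncn_itv; rewrite divr_ge0 // ltW.
move: l1 l2; rewrite ler_pdivlMr // ltr_pdivrMr // => l1 l2.
exists (word a rho (pi / b%:R *+ l) k e m); split.
  exists b; last exact: word_G_ab.
  split; [by rewrite neq_ltn -[X in (X < b)%N](expn0 3) ltn_exp2l ?orbT| |].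
  - by rewrite oddX orbT.
  - by rewrite coprimeXr.
apply: (yB (pi / b%:R *+ l)).
rewrite /ball /= -mulr_natl ltr_norml.
move: l2; rewrite -natr1 mulrDl mul1r => l2.
by apply/andP; split; lra.
Qed.

Lemma G_a_words : coprime a 3 -> G_a a rho = @words R a rho.
Proof.
move=> ca3; apply/seteqP; split => A.
  case=> _ clA; apply: words_closed; apply: closure_subset clA.
  by apply: bigcup_sub => b _; exact: G_ab_words.
move=> wA; split; first exact: words_orthogonal wA.
by case: wA => x [k [e [m ->]]]; exact: word_closure_G_ab.
Qed.

End ClosedGroup.

(** * The submanifold structure *)

Section Chart.
Context {R : realType}.
Implicit Types (t : R) (p A F : 'M[R]_8).

Lemma is_diff_angle (g : R -> R) (g' t : R) (x : 'rV[R]_1) :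
  is_derive (x 0 0 + t) 1 g g' ->
  is_diff x (fun y : 'rV[R]_1 => g (y 0 0 + t)) (fun v => v 0 0 * g').
Proof.
move=> hg.
have dc : is_diff x (fun y : 'rV[R]_1 => y 0 0 + t) (fun v => v 0 0).
  have @f : {linear 'rV[R]_1 -> R}.
    by exists (fun N : 'rV[R]_1 => N 0 0); do 2![eexists]; do ?[constructor];
     rewrite ?mxE// => ? *; rewrite ?mxE//; move=> ?; rewrite !mxE.
  have df : is_diff x (fun y : 'rV[R]_1 => y 0 0 : R) (fun v => v 0 0).
    apply: DiffDef; first exact: differentiable_coord.
    rewrite (_ : (fun y : 'rV[R]_1 => y 0 0 : R) = f) // diff_lin //.
    exact: coord_continuous.
  have := @is_diffD _ _ _ _ _ _ _ _ df (is_diff_cst t x).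
  by rewrite addr0.
have dg : is_diff (x 0 0 + t) g (fun h => h * g').
  have dg1 : differentiable g (x 0 0 + t) by apply/derivable1_diffP.
  apply: DiffDef => //.
  by rewrite diff1E // derive1E derive_val.
exact: (@is_diff_comp _ _ _ _ _ _ _ _ _ dc dg).
Qed.

Lemma is_diff_MD t F (x : 'rV[R]_1) :
  is_diff x (fun y : 'rV[R]_1 => MD (y 0 0 + t) * F)
    (fun v => v 0 0 *: (MD (x 0 0 + (t + pi / 2)) * F)).
Proof.
have e : (fun y : 'rV[R]_1 => MD (y 0 0 + t) * F) =
    (fun y : 'rV[R]_1 => cos (y 0 0 + t) *: F) +
    (fun y : 'rV[R]_1 => sin (y 0 0 + t) *: (MD (pi / 2) * F)).
  by apply/funext => y; rewrite MD_mulE.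
rewrite e.
have dc := is_diff_angle (is_derive_cos (x 0 0 + t)).
have ds := is_diff_angle (is_derive_sin (x 0 0 + t)).
have dcF : is_diff x (fun y : 'rV[R]_1 => cos (y 0 0 + t) *: F)
    (fun v => (v 0 0 * - sin (x 0 0 + t)) *: F).
  apply: DiffDef; first exact: differentiableZl.
  by rewrite diffZl // diff_val.
have dsF : is_diff x (fun y : 'rV[R]_1 => sin (y 0 0 + t) *: (MD (pi / 2) * F))
    (fun v => (v 0 0 * cos (x 0 0 + t)) *: (MD (pi / 2) * F)).
  apply: DiffDef; first exact: differentiableZl.
  by rewrite diffZl // diff_val.
apply: (is_diff_eq (is_diffD dcF dsF)); apply/funext => v /=.
rewrite [RHS](congr1 _ (MD_mulE (x 0 0 + (t + pi / 2)) F)) addrA.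
rewrite cosDpihalf sinDpihalf scalerDr !scalerA.
by [].
Qed.

Lemma derive_MD t F (x v : 'rV[R]_1) :
  'D_v (fun y : 'rV[R]_1 => MD (y 0 0 + t) * F) x =
  v 0 0 *: (MD (x 0 0 + (t + pi / 2)) * F).
Proof. by have d := is_diff_MD t F x; rewrite deriveE // diff_val. Qed.

(** The phase t makes the family stable under differentiation, which shifts t by
    pi/2; the induction also needs the scalar c produced by the direction. *)
Lemma smooth_MD (O : set 'rV[R]_1) t F :
  smooth_on O (fun y : 'rV[R]_1 => MD (y 0 0 + t) * F).
Proof.
suff h k : forall c t, Ck_on k O (fun y : 'rV[R]_1 => c *: (MD (y 0 0 + t) * F)).
  move=> k; have := h k 1 t; congr Ck_on.
  by apply/funext => y; rewrite scale1r.
elim: k => [|k IH] c {}t.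
  split=> // x _; apply: differentiable_continuous.
  by have d := is_diff_MD t F x; exact: differentiableZ.
have d x := is_diff_MD t F x.
split=> [x _|]; first by apply: differentiable_continuous; exact: differentiableZ.
split=> [x v _|v]; first by apply: diff_derivable; exact: differentiableZ.
have -> : (fun x => 'D_v (fun y : 'rV[R]_1 => c *: (MD (y 0 0 + t) * F)) x) =
    (fun y : 'rV[R]_1 => (c * v 0 0) *: (MD (y 0 0 + (t + pi / 2)) * F)).
  apply/funext => x; rewrite deriveZ /=; first by rewrite derive_MD scalerA.
  exact: diff_derivable.
exact: IH.
Qed.

Lemma MD_00 t : MD t 0 0 = cos t.
Proof.
have e0 : (0 : 'I_8) = @lshift 4 4 (@lshift 2 2 0) by exact: val_inj.
rewrite e0.
rewrite [LHS](@block_mxEul R 4 4 4 4) [LHS](@block_mxEul R 2 2 2 2).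
by rewrite mxE /= cosN.
Qed.

Lemma MD_01 t : MD t 0 1 = sin t.
Proof.
have e0 : (0 : 'I_8) = @lshift 4 4 (@lshift 2 2 0) by exact: val_inj.
have e1 : (1 : 'I_8) = @lshift 4 4 (@lshift 2 2 1) by exact: val_inj.
rewrite e0 e1.
rewrite [LHS](@block_mxEul R 4 4 4 4) [LHS](@block_mxEul R 2 2 2 2).
by rewrite mxE /= sinN opprK.
Qed.

Lemma continuous_mul_entry F i j : continuous (fun A : 'M[R]_8 => (A * F) i j : R).
Proof.
rewrite (_ : (fun A => _) = fun A : 'M[R]_8 => \sum_k A i k * F k j); last first.
  by apply/funext => A; rewrite mxE.
apply: continuous_big => /=; first exact: add_continuous.
move=> k _ A; apply: cvgMr_tmp; [exact: (@nbhs_filter _ A)|exact: coord_continuous].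
Qed.

Lemma cos_gt0_circle t : 0 < cos t -> MD (asin (sin t)) = MD t.
Proof.
move=> ct; have s1 : -1 <= sin t <= 1 by rewrite sin_geN1 sin_le1.
rewrite MD_cos_sin [RHS]MD_cos_sin asinK ?in_itv //; congr (_ *: _ + _).
by rewrite cos_asin // -[1](cos2Dsin2 t) addrK sqrtr_sqr gtr0_norm.
Qed.

Lemma sin_bound t : 0 < cos t -> -1 < sin t < 1.
Proof.
move=> ct; have := cos2Dsin2 t => e.
have c2 : 0 < cos t ^+ 2 by rewrite exprn_gt0.
have : `|sin t| ^+ 2 < 1 by rewrite real_normK ?num_real //; lra.
by rewrite expr_lt1 // ltr_norml.
Qed.

(** The parameter t in ]-pi/2, pi/2[ is recovered from A = D(t) p as the arcsine
    of the (0, 1) entry sin t of A p'; positivity of the (0, 0) entry cos t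
    cuts out exactly this arc of the coset.  Injectivity of the differential
    holds since the derivative of D(t) p is D(t + pi/2) p, which is
    invertible. *)
Lemma circle_chart p p' : p * p' = 1 ->
  exists (U : set 'M[R]_8) (O : set 'rV[R]_1) (phi : 'rV[R]_1 -> 'M[R]_8)
         (psi : 'M[R]_8 -> 'rV[R]_1),
  [/\ open U /\ U p, open O,
      smooth_on O phi /\
        (forall x v, O x -> derive phi x v = 0 -> v = 0),
      phi @` O = circle_coset p `&` U &
      (forall x, O x -> psi (phi x) = x) /\ {in U, continuous psi}].
Proof.
move=> pp'.
(* The bounds on the (0, 1) entry keep arcsine continuous on all of U. *)
pose U := [set A : 'M[R]_8 |
  [/\ 0 < (A * p') 0 0, -1 < (A * p') 0 1 & (A * p') 0 1 < 1]].
pose O := [set x : 'rV[R]_1 | - (pi / 2) < x 0 0 /\ x 0 0 < pi / 2].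
(* The phase 0 puts phi in the family of smooth_MD. *)
pose phi := fun x : 'rV[R]_1 => MD (x 0 0 + 0) * p.
pose psi := fun A : 'M[R]_8 => asin ((A * p') 0 1) *: const_mx 1 : 'rV[R]_1.
have phiE t : MD t * p * p' = MD t by rewrite -mulrA pp' mulr1.
have cont i j : continuous (fun A : 'M[R]_8 => (A * p') i j : R).
  exact: continuous_mul_entry.
exists U, O, phi, psi; split.
- split.
    rewrite (_ : U = [set A | 0 < (A * p') 0 0] `&`
       ([set A | -1 < (A * p') 0 1] `&` [set A | (A * p') 0 1 < 1])).
      apply: openI; last apply: openI.
      + apply: (@open_comp _ _ _ [set x : R | 0 < x]);
          last exact: open_gt.
        by move=> A _; exact: cont.
      + apply: (@open_comp _ _ _ [set x : R | -1 < x]);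
          last exact: open_gt.
        by move=> A _; exact: cont.
      + apply: (@open_comp _ _ _ [set x : R | x < 1]);
          last exact: open_lt.
        by move=> A _; exact: cont.
    by apply/seteqP; split=> A [] // h1 [].
  by rewrite /U /= pp' !mxE /= ltr01 ltrN10.
- rewrite (_ : O = [set x : 'rV[R]_1 | - (pi / 2) < x 0 0] `&`
    [set x : 'rV[R]_1 | x 0 0 < pi / 2]) //.
  apply: openI.
  + apply: (@open_comp _ _ _ [set x : R | - (pi / 2) < x]);
      last exact: open_gt.
    by move=> A _; exact: coord_continuous.
  + apply: (@open_comp _ _ _ [set x : R | x < pi / 2]);
      last exact: open_lt.
    by move=> A _; exact: coord_continuous.
- split; first exact: smooth_MD.
  move=> x v _; rewrite derive_MD => /eqP; rewrite scaler_eq0 => /orP[/eqP v0|/eqP].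
    by apply/matrixP => i j; rewrite !ord1 mxE.
  set y := _ + _ => /(congr1 (fun A => MD (- y) * A * p')).
  rewrite mulrA MDD addNr MD0 mul1r pp' mulr0 mul0r => /eqP.
  by rewrite oner_eq0.
- apply/seteqP; split.
    move=> _ [x [x1 x2] <-]; split; first by exists (x 0 0 + 0).
    rewrite /U /= /phi phiE MD_00 MD_01 addr0.
    have c0 : 0 < cos (x 0 0) by apply: cos_gt0_pihalf; rewrite x1.
    by have /andP[] := sin_bound c0.
  move=> _ [[t _ <-]]; rewrite /U /= phiE MD_00 MD_01 => -[c0 s1 s2].
  exists (asin (sin t) *: const_mx 1).
    rewrite /O /= !mxE mulr1; split.
      by apply: asin_gtNpi2; rewrite s1 ltW.
    by apply: asin_ltpi2; rewrite s2 ltW.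
  by rewrite /phi !mxE mulr1 addr0 cos_gt0_circle.
- split.
    move=> x [x1 x2]; rewrite /psi /phi phiE MD_01 addr0 sinK; last first.
      by rewrite in_itv /= !ltW.
    by apply/matrixP => i j; rewrite !mxE !ord1 mulr1.
  move=> A; rewrite inE => -[_ s1 s2].
  apply: cvgZr_tmp; first exact: (@nbhs_filter _ A).
  apply: (@continuous_comp _ _ _ (fun A : 'M[R]_8 => (A * p') 0 1 : R) (@asin R)).
    exact: cont.
  by apply: continuous_asin; rewrite s1 s2.
Qed.

End Chart.

Section Submanifold.
Context {R : realType}.
Variables (a rho : nat).
Hypotheses (aodd : odd a) (a_gt2 : (2 < a)%N) (rho_odd : odd rho)
  (rho_sq : (rho ^ 2 + 1 = 0 %[mod a])%N).

(** Two cosets of the circle are equal or disjoint, so off the closed union of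
    the cosets avoiding p the group is the coset of p, where the chart above
    applies. *)
Lemma words_submanifold : submanifold 1 (@words R a rho).
Proof.
move=> p wp.
have [p' _ pp'] := words_inv aodd a_gt2 rho_odd rho_sq wp.
have [U [V [phi [psi [[oU Up] oV smo im [inv cont]]]]]] := circle_chart pp'.
pose P := [set i : 'I_(2 * a) * 'I_4 * 'I_8 | ~ circle_coset (coset_rep rho i) p].
pose K : set 'M[R]_8 := \bigcup_(i in P) circle_coset (coset_rep rho i).
have cK : closed K.
  apply: compact_closed; first exact: norm_hausdorff.
  exact: finite_union_cosets_compact.
have WK : words a rho `&` ~` K = circle_coset p.
  have cst (F A : 'M[R]_8) (t : R) : circle_coset F A -> circle_coset F (MD t * A).
    by move=> [x _ <-]; exists (t + x) => //; rewrite mulrA MDD.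
  apply/seteqP; split => A.
    rewrite words_cosets // => -[[i _ iA] nK].
    have [q pq] : circle_coset (coset_rep rho i) p.
      by apply: contrapT => h; apply: nK; exists i.
    move: iA => [x _ <-] <-; exists (x - q) => //.
    by rewrite mulrA MDD subrK.
  move=> [x _ <-]; split; first exact: words_mulD.
  move=> [i Pi h]; apply: Pi; have := cst _ _ (- x) h.
  by rewrite mulrA MDD addNr MD0 mul1r.
exists (~` K `&` U), V, phi, psi; split => //.
- split; first by apply: openI => //; exact: closed_openC.
  split=> //.
  have : circle_coset p p by exists 0 => //; rewrite MD0 mul1r.
  by rewrite -WK => -[].
- by rewrite im setIA WK.
- split=> //; apply: continuous_in_subspaceT => A; rewrite inE => -[_ [_ UA]].
  by apply: cont; rewrite inE.
Qed.

End Submanifold.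

(** * Isotropy and irreducibility *)

Section Columns.
Context {R : realType}.
Implicit Types (u : 'cV[R]_2) (x : R).

Definition col8 u1 u2 u3 u4 : 'cV[R]_8 :=
  @col_mx R 4 4 1 (@col_mx R 2 2 1 u1 u2) (@col_mx R 2 2 1 u3 u4).

Lemma col8P (y : 'cV[R]_8) : exists u1 u2 u3 u4, y = col8 u1 u2 u3 u4.
Proof.
exists (@usubmx R 2 2 1 (@usubmx R 4 4 1 y)), (@dsubmx R 2 2 1 (@usubmx R 4 4 1 y)).
exists (@usubmx R 2 2 1 (@dsubmx R 4 4 1 y)), (@dsubmx R 2 2 1 (@dsubmx R 4 4 1 y)).
by rewrite /col8 !vsubmxK.
Qed.

Lemma col8_inj u1 u2 u3 u4 v1 v2 v3 v4 :
  col8 u1 u2 u3 u4 = col8 v1 v2 v3 v4 -> [/\ u1 = v1, u2 = v2, u3 = v3 & u4 = v4].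
Proof.
move=> /(@eq_col_mx R 4 4 1)[].
by move=> /(@eq_col_mx R 2 2 1)[-> ->] /(@eq_col_mx R 2 2 1)[-> ->].
Qed.

Lemma add_col8 u1 u2 u3 u4 v1 v2 v3 v4 :
  col8 u1 u2 u3 u4 + col8 v1 v2 v3 v4 = col8 (u1 + v1) (u2 + v2) (u3 + v3) (u4 + v4).
Proof. by rewrite /col8 (@add_col_mx R 4 4 1) !(@add_col_mx R 2 2 1). Qed.

Lemma scale_col8 x u1 u2 u3 u4 :
  x *: col8 u1 u2 u3 u4 = col8 (x *: u1) (x *: u2) (x *: u3) (x *: u4).
Proof. by rewrite /col8 (@scale_col_mx R 4 4 1) !(@scale_col_mx R 2 2 1). Qed.

Lemma mul_B4_col A B C D u1 u2 :
  B4 A B C D *m (@col_mx R 2 2 1 u1 u2) =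
  @col_mx R 2 2 1 (A *m u1 + B *m u2) (C *m u1 + D *m u2).
Proof. exact: (@mul_block_col R 2 2 2 2 1). Qed.

Lemma mul_B8_col A B C D (v1 v2 : 'cV[R]_4) :
  B8 A B C D *m (@col_mx R 4 4 1 v1 v2) =
  @col_mx R 4 4 1 (A *m v1 + B *m v2) (C *m v1 + D *m v2).
Proof. exact: (@mul_block_col R 4 4 4 4 1). Qed.

Lemma torus_col8 x1 x2 x3 x4 u1 u2 u3 u4 :
  torus x1 x2 x3 x4 *m col8 u1 u2 u3 u4 =
  col8 (mr x1 *m u1) (mr x2 *m u2) (mr x3 *m u3) (mr x4 *m u4).
Proof.
rewrite /torus /col8 mul_B8_col !mul0mx addr0 add0r !mul_B4_col !mul0mx.
by rewrite !addr0 !add0r.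
Qed.

Lemma MQ_col8 u1 u2 u3 u4 :
  MQ *m col8 u1 u2 u3 u4 = col8 u2 (- u1) (- u4) u3.
Proof.
rewrite MQE /col8 mul_B8_col !mul0mx addr0 add0r !mul_B4_col !mul0mx !mulNmx !mul1mx.
by rewrite !addr0 !add0r.
Qed.

Lemma MS_col8 u1 u2 u3 u4 :
  MS *m col8 u1 u2 u3 u4 =
  col8 (- (conj_mx *m u2)) (conj_mx *m u1) (- (conj_mx *m u4)) (conj_mx *m u3).
Proof.
rewrite MSE /col8 mul_B8_col !mul0mx addr0 add0r !mul_B4_col !mul0mx !mulNmx.
by rewrite !addr0 !add0r.
Qed.

Lemma MV_col8 u1 u2 u3 u4 :
  MV *m col8 u1 u2 u3 u4 =
  col8 u3 u4 (- (conj_mx *m u2)) (conj_mx *m u1).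
Proof.
rewrite MVE /col8 mul_B8_col !mul0mx mul1mx addr0 add0r !mul_B4_col !mul0mx !mulNmx.
by rewrite !addr0 !add0r.
Qed.

(** mr x + mr (- x) is the scalar matrix 2 cos x, so a vector fixed by mr x, and
    hence by its inverse, satisfies 2 cos x u = 2 u. *)
Lemma mr_fix x u : cos x != 1 -> mr x *m u = u -> u = 0.
Proof.
move=> cx fu.
have fu' : mr (- x) *m u = u by rewrite -{1}fu mulmxA mrD addNr mr0 mul1mx.
have : (mr x + mr (- x)) *m u = u + u by rewrite mulmxDl fu fu'.
have -> : mr x + mr (- x) = (cos x *+ 2)%:M.
  by apply: eq_mx2; rewrite !mxE /= ?cosN ?sinN ?opprK ?mulr1n ?mulr0n; ring.
rewrite mul_scalar_mx -mulr2n -(scaler_nat 2 u) => /eqP.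
rewrite -subr_eq0 -scalerBl scaler_eq0 => /orP[|/eqP //].
by rewrite -mulrnBl mulrn_eq0 /= subr_eq0 (negbTE cx).
Qed.

Lemma cos_neq1 x : 0 < x <= pi -> cos x != 1.
Proof.
move=> /andP[x0 xpi]; apply/eqP; rewrite -cos0 => /cos_inj.
rewrite !in_itv /= !pi_ge0 lexx xpi ltW // => /(_ isT isT) x0'.
by rewrite x0' ltxx in x0.
Qed.

End Columns.

Section Representation.
Context {R : realType}.
Variables (a rho : nat).
Hypotheses (aodd : odd a) (a_gt2 : (2 < a)%N) (rho_lt : (rho < a)%N)
  (rho_odd : odd rho) (rho_sq : (rho ^ 2 + 1 = 0 %[mod a])%N).

Lemma rho_gt1 : (1 < rho)%N.
Proof.
case: rho rho_odd rho_sq => [//|[_|//]].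
by rewrite mod0n modn_small.
Qed.

Definition base_point : 'cV[R]_8 := col8 (delta_mx 0 0) 0 0 0.

Lemma mr_quarter : mr (pi / 2) *m delta_mx 0 0 = delta_mx 1 0 :> 'cV[R]_2.
Proof.
apply/matrixP => i j; rewrite !ord1 !mxE !big_ord_recl !big_ord0 !mxE /=.
rewrite cos_pihalf sin_pihalf.
by case: i => [[|[|//]] ?]; rewrite /= ?mulr0 ?mulr1 ?addr0.
Qed.

Lemma conj_fix (u : 'cV[R]_2) : conj_mx *m u = u -> u = u 0 0 *: delta_mx 0 0.
Proof.
move=> h; have := congr1 (fun A : 'cV[R]_2 => A 1 0) h.
rewrite !mxE !big_ord_recl !big_ord0 !mxE /= mul0r add0r addr0 mulN1r => h1.
have e : lift ord0 (ord0 : 'I_1) = 1 :> 'I_2 by exact: val_inj.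
rewrite e in h1.
have u1 : u 1 0 = 0 by lra.
apply/matrixP => i j; rewrite !ord1 !mxE.
case: i => [[|[|//]] hi] /=.
  by rewrite mulr1; congr (u _ _); exact: val_inj.
by rewrite mulr0 -[RHS]u1; congr (u _ _); exact: val_inj.
Qed.

(** C D(t) with t = pi/a rotates the four blocks by 0, 2t, (rho - 1) t and
    (rho + 1) t.  The last three angles lie in ]0, pi], since 1 < rho < a, so
    only the first block of a fixed vector survives; Q S acts on it as complex
    conjugation and leaves its real part. *)
Lemma Fix_isotropy_base_point (y : 'cV[R]_8) :
  Fix (isotropy (words a rho) base_point) y -> exists l, y = l *: base_point.
Proof.
have [wD wC wQ wS wV] := @words_gen R a rho aodd a_gt2 rho_odd rho_sq.
have wM := @words_mul R a rho aodd a_gt2 rho_odd rho_sq.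
have a0 : 0 < a%:R :> R by rewrite ltr0n; case: (a) a_gt2.
pose t : R := pi / a%:R.
have t0 : 0 < t by rewrite divr_gt0 ?pi_gt0.
have tle k : (k <= a)%N -> t *+ k <= pi.
  move=> ka; rewrite -mulr_natl /t mulrCA ger_pMr ?pi_gt0 //.
  by rewrite ler_pdivrMr // mul1r ler_nat.
have CD : MC a rho * MD t = torus 0 (t *+ 2) (t *+ rho.-1) (t *+ rho.+1).
  have e3 : t *+ rho - t = t *+ rho.-1.
    by rewrite -{1}(prednK (ltnW rho_gt1)) mulrSr addrK.
  by rewrite MC_torus MD_torus mul_torus -/t subrr e3 -mulr2n -mulrSr.
have [u1 [u2 [u3 [u4 ->]]]] := col8P y => fy.
have i1 : isotropy (words a rho) base_point (MC a rho * MD t).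
  split; first exact: wM.
  by rewrite CD /base_point torus_col8 !mulmx0 mr0 mul1mx.
have := fy _ i1; rewrite CD torus_col8 mr0 mul1mx.
have r1 := rho_gt1.
have cosn k : (0 < k)%N -> (k <= a)%N -> cos (t *+ k) != 1.
  by move=> k0 ka; apply: cos_neq1; rewrite tle // pmulrn_lgt0 // t0.
move=> /col8_inj[_ f2 f3 f4].
have u20 : u2 = 0 by apply: mr_fix f2; apply: cosn => //; exact: ltnW.
have u30 : u3 = 0 by apply: mr_fix f3; apply: cosn; lia.
have u40 : u4 = 0 by apply: mr_fix f4; apply: cosn; lia.
have QS (u : 'cV[R]_2) : (MQ * MS) *m col8 u 0 0 0 = col8 (conj_mx *m u) 0 0 0.
  by rewrite -[MQ * MS]/(MQ *m MS) -mulmxA MS_col8 MQ_col8 !mulmx0 !oppr0.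
have i2 : isotropy (words a rho) base_point (MQ * MS).
  split; first exact: wM.
  rewrite QS; congr col8; apply/matrixP => i j.
  rewrite !ord1 !mxE !big_ord_recl !big_ord0 !mxE /=.
  by case: i => [[|[|//]] ?]; rewrite /= ?mulr0 ?mulr1 ?addr0.
have := fy _ i2; rewrite u20 u30 u40 QS.
move=> /col8_inj[/conj_fix -> _ _ _]; exists (u1 0 0).
by rewrite /base_point scale_col8 !scaler0.
Qed.

(** Rotating the base point by D(-pi/2) gives the whole first block, and S, V S
    and V carry the first block onto the other three. *)
Lemma words_abs_irreducible : abs_irreducible (@words R a rho).
Proof.
have [wD wC wQ wS wV] := @words_gen R a rho aodd a_gt2 rho_odd rho_sq.
move=> L LG.
have [l Le1] : exists l, L base_point = l *: base_point.
  by apply: Fix_isotropy_base_point => A [GA Ae]; rewrite -LG // Ae.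
exists l => y.
pose good v := L v = l *: v.
have goodG A v : words a rho A -> good v -> good (A *m v).
  by move=> wA gv; rewrite /good LG // gv scalemxAr.
have goodD v w : good v -> good w -> good (v + w).
  by move=> gv gw; rewrite /good linearD /= gv gw scalerDr.
have goodZ x v : good v -> good (x *: v).
  by move=> gv; rewrite /good linearZ /= gv !scalerA mulrC.
have g1 u : good (col8 u 0 0 0).
  have -> : col8 u 0 0 0 =
      u 0 0 *: base_point + u 1 0 *: (MD (- (pi / 2)) *m base_point).
    rewrite /base_point MD_torus torus_col8 opprK mr_quarter !mulmx0.
    rewrite !scale_col8 add_col8.
    rewrite !scaler0 !addr0; congr col8.
    apply/matrixP => i j; rewrite !ord1 !mxE.
    case: i => [[|[|//]] hi]; rewrite /= ?mulr0 ?mulr1 ?addr0 ?add0r;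
      by congr (u _ _); exact: val_inj.
  by apply: goodD; apply: goodZ => //; exact: goodG.
have [u1 [u2 [u3 [u4 ->]]]] := col8P y.
have -> : col8 u1 u2 u3 u4 = col8 u1 0 0 0 + MS *m col8 (conj_mx *m u2) 0 0 0 +
    MV *m (MS *m col8 (- u3) 0 0 0) + MV *m col8 (conj_mx *m u4) 0 0 0.
  rewrite !(MS_col8, MV_col8, add_col8) !mulmx0 !oppr0 !mulmx0 !mulmxA !conjK !mul1mx.
  by rewrite opprK !(addr0, add0r).
by do 3?apply: (goodD); do ?apply: (goodG).
Qed.

Lemma words_isotropy_dim1 :
  exists x : 'cV[R]_8, has_dim (Fix (isotropy (@words R a rho) x)) 1.
Proof.
exists base_point, <[base_point]>%VS; split; last first.
  rewrite dim_vline; suff -> : base_point != 0 by [].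
  apply/eqP => h; have : base_point = col8 0 0 0 0.
    by rewrite h; have := @scale_col8 R 0 0 0 0 0; rewrite !scale0r.
  move=> /col8_inj[/(congr1 (fun A : 'cV[R]_2 => A 0 0))].
  by rewrite !mxE /= => /eqP; rewrite oner_eq0.
apply/seteqP; split => y /=.
  by move=> /Fix_isotropy_base_point[l ->]; apply/vlineP; exists l.
by move=> /vlineP[l ->] A [_ Ae]; rewrite -scalemxAr Ae.
Qed.

End Representation.

Theorem theorem1p6 (R : realType) (a rho : nat) (ha : inA a)
    (rho_lt : (rho < a)%N) (rho_odd : odd rho)
    (rho_sq : (rho ^ 2 + 1 = 0 %[mod a])%N) :
  [/\ @G_a R a rho =
        generated ([set MC a rho; MQ; MS; MV] `|`
                   [set MD psi | psi in [set: R]]),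
      compact (@G_a R a rho) /\ matrix_Lie_group 1 (@G_a R a rho),
      abs_irreducible (@G_a R a rho) &
      exists x : 'cV[R]_8, has_dim (Fix (isotropy (@G_a R a rho) x)) 1].
Proof.
have aodd := inA_odd ha; have a_gt2 := inA_gt2 ha.
rewrite (G_a_words aodd a_gt2 rho_odd rho_sq (inA_coprime3 ha)); split.
- exact: words_generated.
- split; first exact: words_compact.
  by split; [exact: words_group|exact: words_submanifold].
- exact: words_abs_irreducible.
- exact: words_isotropy_dim1.
Qed.
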